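(* Let $G$ be a connected graph with $n \geq 2$ vertices and maximum degree $\Delta(G)$. Then $\gamma_t(G) \geq \left\lceil \frac{n}{\Delta(G)} \right\rceil$.
   Context: Graphs are finite, simple and undirected. A set $S$ of vertices in a graph $G=(V,E)$ is called a total dominating set if every vertex $v\in V$ (including those in $S$) is adjacent to some element of $S$. The total domination number $\gamma_t(G)$ is the minimum cardinality of a total dominating set of $G$. *)

(* Defs.v *)
From mathcomp Require Import all_boot all_order all_algebra.

Set Implicit Arguments.
Unset Strict Implicit.
Unset Printing Implicit Defensive.

(* A finite simple graph is a symmetric irreflexive relation [e] on a finType,
   whose elements are the vertices. *)

Definition simple_graph (T : finType) (e : rel T) : Prop :=
  symmetric e /\ irreflexive e.

(* This also holds of the graph with no vertex. *)
Definition connected_graph (T : finType) (e : rel T) : Prop :=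
  forall x y : T, connect e x y.

Definition degree (T : finType) (e : rel T) (x : T) : nat :=
  #|[set y | e x y]|.

Definition max_degree (T : finType) (e : rel T) : nat :=
  \max_(x : T) degree e x.

Definition total_dominating (T : finType) (e : rel T) (S : {set T}) : bool :=
  [forall v : T, exists u in S, e v u].

(* The full vertex set is total dominating as soon as any set is, that is, when
   there is no isolated vertex. With an isolated vertex no minimum exists, and
   this value is #|T| by convention. *)
Definition total_domination_number (T : finType) (e : rel T) : nat :=
  #|[arg min_(S < [set: T] | total_dominating e S) #|S|]|.

(* Main.v *)
Require Import Defs.
From mathcomp Require Import all_boot all_order all_algebra.

(** The open neighbourhoods of the vertices of a total dominating set [S] cover
    the whole vertex set, and each of them has at most Delta elements; hence
    n <= |S| * Delta ([card_le_total_dominating]).  As |S| is an integer,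
    dividing by Delta and rounding up gives the bound.

    Applying this to a minimum total dominating set requires that one exists.
    Connectedness and n >= 2 provide this: no vertex is isolated, so the set of
    all vertices is total dominating ([total_dominating_setT]). *)

Section TotalDomination.

Variables (T : finType) (e : rel T).

Lemma degree_le_max (x : T) : degree e x <= max_degree e.
Proof. exact: (leq_bigmax (F := degree e)). Qed.

Lemma connected_has_neighbor (x : T) :
  connected_graph e -> 2 <= #|T| -> exists y, e x y.
Proof.
move=> conn_e card_ge2.
have /card_gt0P[y] : 0 < #|predC1 x| by rewrite cardC1 -subn1 subn_gt0.
rewrite inE => y_neq_x.
have /connectP[[|z p] /= path_p last_p] := conn_e x y.
  by rewrite last_p eqxx in y_neq_x.
by exists z; case/andP: path_p.
Qed.

Lemma total_dominating_setT :
  connected_graph e -> 2 <= #|T| -> total_dominating e [set: T].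
Proof.
move=> conn_e card_ge2; apply/forallP => v.
have [u e_vu] := connected_has_neighbor v conn_e card_ge2.
by apply/existsP; exists u; rewrite in_setT.
Qed.

(** Double counting of the pairs (v, u) with [u] in [S] adjacent to [v]: every
    vertex [v] occurs at least once, every [u] at most Delta times. *)
Lemma card_le_total_dominating (S : {set T}) :
  symmetric e -> total_dominating e S -> #|T| <= #|S| * max_degree e.
Proof.
move=> sym_e /forallP dom_S.
have count_v (v : T) : 1 <= \sum_(u in S) e v u.
  have /existsP[u /andP[u_S e_vu]] := dom_S v.
  by rewrite (bigD1 u) //= e_vu.
apply: (@leq_trans (\sum_(v : T) \sum_(u in S) e v u)).
  by rewrite -sum1_card; apply: leq_sum.
rewrite exchange_big -sum_nat_const /=; apply: leq_sum => u _.
apply: leq_trans (degree_le_max u).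
rewrite /degree -sum1_card big_mkcond [leqRHS]big_mkcond /=.
by apply: leq_sum => v _; rewrite inE sym_e; case: (e u v).
Qed.

End TotalDomination.

Theorem theorem1 (T : finType) (e : rel T)
    (graph_e : simple_graph e)
    (connected_e : connected_graph e)
    (card_ge2 : (2 <= #|T|)%N) :
  (Num.ceil ((#|T|%:R / (max_degree e)%:R)%R : rat)
     <= (total_domination_number e)%:Z)%R.
Proof.
have [sym_e _] := graph_e.
rewrite /total_domination_number.
case: arg_minnP => [|S dom_S _]; first exact: total_dominating_setT.
have card_le := card_le_total_dominating _ _ S sym_e dom_S.
have max_gt0 : 0 < max_degree e.
  by case: (max_degree e) card_le => //; rewrite muln0 leqNgt (ltnW card_ge2).
rewrite Num.Theory.ceil_le_int Num.Theory.ler_pdivrMr ?Num.Theory.ltr0n //.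
by rewrite -pmulrn -GRing.natrM Num.Theory.ler_nat.
Qed.
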